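(* For every integer $n\ge 1$ there exists a constant $c_n>0$, depending only on $n$, such that for every function $u:[0,1]^n\to\mathbb{R}$ that is continuous on $[0,1]^n$, twice continuously differentiable on $(0,1)^n$, and satisfies $\Delta u\ge 1$ on $(0,1)^n$, $$\left|\left\{x\in[0,1]^n: |u(x)|\ge c_n\right\}\right|\cdot \|u\|_{L^\infty([0,1]^n)}\ge c_n.$$
   Context: $|\cdot|$ applied to a set denotes $n$-dimensional Lebesgue measure, and $\Delta u=\sum_{i=1}^n\partial_{x_i}^2u$ is the Laplacian. *)

(* Defs.v *)
From HB Require Import structures.
From mathcomp Require Import all_boot all_order all_algebra.
From mathcomp Require Import all_classical all_reals all_analysis.

Set Implicit Arguments.
Unset Strict Implicit.
Unset Printing Implicit Defensive.

Import Order.TTheory GRing.Theory Num.Theory.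
Import numFieldNormedType.Exports.

Local Open Scope classical_set_scope.
Local Open Scope ring_scope.

(* MathComp-Analysis only provides Lebesgue measure on the line.  Below, row
   vectors carry the sigma-algebra generated by the coordinates (that is, the
   Borel sigma-algebra), and n-dimensional Lebesgue measure is the n-fold
   product of [lebesgue_measure], built by recursion on n; [lebesgue_rV_box]
   gives its value on boxes. *)
Section measurable_rV.
Context (R : realType) (n : nat).

Definition rV_coord (i : 'I_n) (x : 'rV[R]_n) : R := x 0 i.

Let rV_set0 : g_sigma_preimage rV_coord set0.
Proof. exact: sigma_algebra0. Qed.

Let rV_setC A : g_sigma_preimage rV_coord A -> g_sigma_preimage rV_coord (~` A).
Proof. exact: sigma_algebraC. Qed.

Let rV_bigcup (F : (set 'rV[R]_n)^nat) :
  (forall i, g_sigma_preimage rV_coord (F i)) ->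
  g_sigma_preimage rV_coord (\bigcup_i (F i)).
Proof. exact: sigma_algebra_bigcup. Qed.

HB.instance Definition _ :=
  @isMeasurable.Build (measure_tuple_display default_measure_display)
    'rV[R]_n (g_sigma_preimage rV_coord) rV_set0 rV_setC rV_bigcup.

Lemma measurable_rV_coord (i : 'I_n) : measurable_fun [set: 'rV[R]_n] (rV_coord i).
Proof.
move=> _ Y mY; rewrite setTI; apply: sub_sigma_algebra => /=.
rewrite -bigcup_seq/=; exists i => /=; first by rewrite mem_index_enum.
by exists Y => //; rewrite setTI.
Qed.

Lemma measurable_fun_rV d (T : measurableType d) (f : T -> 'rV[R]_n) :
  (forall i, measurable_fun [set: T] (rV_coord i \o f)) ->
  measurable_fun [set: T] f.
Proof.
move=> mf _ A mA.
have prefS : g_sigma_preimage (fun i => rV_coord i \o f) `<=` measurable.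
  apply: smallest_sub; first exact: sigma_algebra_measurable.
  rewrite -bigcup_seq; apply: bigcup_sub => i _ B [C mC <-].
  exact: mf.
by apply: prefS; rewrite g_sigma_preimage_comp; exists A.
Qed.

End measurable_rV.

Section lebesgue_rV.
Context {R : realType}.

Definition rV_cons n (p : measurableTypeR R * 'rV[R]_n) : 'rV[R]_n.+1 :=
  \row_i (if unlift ord0 i is Some j then p.2 0 j else p.1).

Definition rV_uncons n (x : 'rV[R]_n.+1) : measurableTypeR R * 'rV[R]_n :=
  (x 0 ord0, \row_j x 0 (lift ord0 j)).

Lemma rV_consK n : cancel (@rV_cons n) (@rV_uncons n).
Proof.
move=> [a x]; congr (_, _); first by rewrite mxE unlift_none.
by apply/rowP => j; rewrite !mxE liftK.
Qed.

Lemma measurable_rV_cons n : measurable_fun setT (@rV_cons n).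
Proof.
apply: measurable_fun_rV => i; rewrite /comp /rV_coord /rV_cons /=.
case: (unliftP ord0 i) => [j|] ->.
  rewrite (_ : (fun _ => _) = @rV_coord R n j \o snd).
    by apply: measurableT_comp => //; exact: measurable_rV_coord.
  by apply/funext => p; rewrite /= mxE liftK.
rewrite (_ : (fun _ => _) = fst)//.
by apply/funext => p; rewrite mxE unlift_none.
Qed.

Lemma measurable_rV_uncons n : measurable_fun setT (@rV_uncons n).
Proof.
apply/measurable_fun_pairP; split; first exact: (@measurable_rV_coord R n.+1 ord0).
apply: measurable_fun_rV => i.
rewrite (_ : _ \o _ = @rV_coord R n.+1 (lift ord0 i)).
  exact: measurable_rV_coord.
by apply/funext => x; rewrite /= /rV_coord mxE.
Qed.

Section step.
Context n (mu : {sigma_finite_measure set 'rV[R]_n -> \bar R}).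

Definition lebesgue_rV_step : set 'rV[R]_n.+1 -> \bar R :=
  pushforward (lebesgue_measure \x mu)%E (@rV_cons n).

Let prod_mu : {measure set (measurableTypeR R * 'rV[R]_n)%type -> \bar R} := (lebesgue_measure \x mu)%E.

Let step0 : lebesgue_rV_step set0 = 0%E.
Proof. by rewrite /lebesgue_rV_step /pushforward preimage_set0 measure0. Qed.

Let step_ge0 A : (0 <= lebesgue_rV_step A)%E.
Proof. exact: (measure_ge0 prod_mu). Qed.

Let step_sigma_additive : semi_sigma_additive lebesgue_rV_step.
Proof.
have mpre A : measurable A -> measurable (@rV_cons n @^-1` A).
  by move=> mA; rewrite -[X in measurable X]setTI; exact: measurable_rV_cons.
move=> F mF tF mUF; rewrite /lebesgue_rV_step /pushforward preimage_bigcup.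
apply: (@measure_semi_sigma_additive _ _ _ prod_mu).
- by move=> k; exact: mpre.
- apply/trivIsetP => /= i j _ _ ij; rewrite -preimage_setI.
  by move/trivIsetP : tF => /(_ _ _ _ _ ij) ->//; rewrite preimage_set0.
- by rewrite -preimage_bigcup; exact: mpre.
Qed.

HB.instance Definition _ := isMeasure.Build _ _ _
  lebesgue_rV_step step0 step_ge0 step_sigma_additive.

Let step_sigma_finite : sigma_finite setT lebesgue_rV_step.
Proof.
have /sigma_finiteP[F [TF ndF Foo]] := sigma_finiteT (@lebesgue_measure R).
have /sigma_finiteP[G [TG ndG Goo]] := sigma_finiteT mu.
exists (fun k => @rV_uncons n @^-1` (F k `*` G k)).
  rewrite -preimage_bigcup -(@preimage_setT _ _ (@rV_uncons n)); congr (_ @^-1` _).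
  rewrite -setXTT TF TG; apply/seteqP; split=> -[x y].
    move=> [/= [i _ Fx] [j _ Gy]]; exists (maxn i j) => //; split.
    - by move: x Fx; exact/subsetPset/ndF/leq_maxl.
    - by move: y Gy; exact/subsetPset/ndG/leq_maxr.
  by move=> [k _ []/= ? ?]; split; exists k.
move=> k; have [mF Fk] := Foo k; have [mG Gk] := Goo k.
split.
  rewrite -[X in measurable X]setTI.
  by apply: measurable_rV_uncons => //; exact: measurableX.
rewrite /lebesgue_rV_step /pushforward (_ : _ @^-1` _ = F k `*` G k).
  by rewrite product_measure1E// lte_mul_pinfty// ge0_fin_numE.
by rewrite -comp_preimage (funext (@rV_consK n : _ \o _ =1 id)) preimage_id.
Qed.

HB.instance Definition _ := Measure_isSigmaFinite.Build _ _ _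
  lebesgue_rV_step step_sigma_finite.

End step.

Fixpoint lebesgue_rV n : {sigma_finite_measure set 'rV[R]_n -> \bar R} :=
  if n is m.+1 then lebesgue_rV_step (lebesgue_rV m) else \d_(0 : 'rV[R]_0).

Lemma lebesgue_rV_box n (A : 'I_n -> set (measurableTypeR R)) :
  (forall i, measurable (A i)) ->
  lebesgue_rV n [set x : 'rV[R]_n | forall i, A i (x 0 i)]
  = (\prod_(i < n) lebesgue_measure (A i))%E.
Proof.
elim: n A => [|n IH] A mA.
  by rewrite big_ord0 /= diracE mem_set//= => -[].
rewrite big_ord_recl -(IH (fun j => A (lift ord0 j)))//.
rewrite -product_measure1E//; last first.
  rewrite (_ : mkset _ = \bigcap_(j in [set: 'I_n])
      @rV_coord R n j @^-1` A (lift ord0 j)); last first.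
    by apply/seteqP; split=> x /= Ax j; [move=> _|]; exact: Ax.
  apply: fin_bigcap_measurable => [|j _]; first exact: finite_finset.
  rewrite -[X in measurable X]setTI.
  by apply: measurable_rV_coord; [exact: measurableT|exact: mA].
congr ((_ \x _)%E _); apply/seteqP; split => -[a x] /=.
  move=> Ax; split=> [|j].
    by have := Ax ord0; rewrite mxE unlift_none.
  by have := Ax (lift ord0 j); rewrite mxE liftK.
move=> [Aa Ax] i; rewrite mxE.
by case: (unliftP ord0 i) => [j|] ->.
Qed.

End lebesgue_rV.

Section cube.
Context (R : realType) (n : nat).

Definition closed_cube : set 'rV[R]_n := [set x | forall i, 0 <= x 0 i <= 1].

Definition open_cube : set 'rV[R]_n := [set x | forall i, 0 < x 0 i < 1].

End cube.
Arguments closed_cube {R} n.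
Arguments open_cube {R} n.

Section differential_operators.
Context (R : realType) (n : nat).
Implicit Types (U : set 'rV[R]_n) (f : 'rV[R]_n -> R).

Definition partial (i : 'I_n) f : 'rV[R]_n -> R := 'D_('e_i) f.

Definition laplacian f (x : 'rV[R]_n) : R :=
  \sum_(i < n) partial i (partial i f) x.

(* [U] is meant to be open; only the values of [f] on [U] then matter. *)
Fixpoint continuously_differentiable (k : nat) U f : Prop :=
  {within U, continuous f} /\
  if k is m.+1 then
    forall i, (forall x, U x -> derivable f x 'e_i) /\
              continuously_differentiable m U (partial i f)
  else True.

End differential_operators.

(* Main.v *)
Require Import Defs.
From mathcomp Require Import all_boot all_order all_algebra.
From mathcomp Require Import all_classical all_reals all_analysis.
From mathcomp Require Import measurable_realfun ess_sup_inf lra ring.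

Set Implicit Arguments.
Unset Strict Implicit.
Unset Printing Implicit Defensive.

Import Order.TTheory GRing.Theory Num.Theory.
Import numFieldNormedType.Exports.

Local Open Scope classical_set_scope.
Local Open Scope ring_scope.

(** Why the estimate holds.  Fix a nonnegative weight w supported in the box
Q = [1/4, 3/4]^n, inside the open cube, and vanishing to second order on the
boundary of Q.  Two integrations by parts move the Laplacian from u to w:

   int_Q w <= int_Q w Delta u = int_Q u Delta w <= sup |Delta w| int_Q |u|,

so the integral of |u| over the unit cube is bounded below by a constant that
depends on n only ([integral_normr_ge]).  On the other hand, |u| is less than c
off the superlevel set A = { |u| >= c } and at most the essential supremum on A,
so that this integral is at most c + |A| N, with N the norm of u
([integral_le_Lnormy]).  With c half of the lower bound, the term |A| N is at
least the other half.

The weight is w(x) = \prod_j g(x_j) with g(t) = (1/16 - (t - 1/2)^2)^2 on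
[1/4, 3/4].  Being a product, it reduces Green's identity to one variable:
the i-th part w d_i d_i u - u d_i d_i w is, on every line parallel to the i-th
axis, the derivative of a function that vanishes at both ends of the segment cut
by Q, because g and g' vanish there ([bell_integration_by_parts]).  Hence its
integral over each line is 0, and Fubini's theorem makes its integral over Q
vanish ([integral_lines_eq0], [flux_integral]).  The derivatives of u may be
unbounded near the boundary of the cube; Q keeps away from it. *)

(** * Borel sets and boxes among row vectors *)

Section topology_of_rV.
Context (R : realType) (n : nat).
Implicit Types (A D : set 'rV[R]_n) (a b : R).

Lemma measurable_coord_box (I : 'I_n -> interval R) :
  measurable [set x : 'rV[R]_n | forall i, x 0 i \in I i].
Proof.
rewrite (_ : mkset _ = \bigcap_(i in [set: 'I_n])
    @rV_coord R n i @^-1` [set` I i]); last first.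
  by apply/seteqP; split=> x /= xI i; [move=> _|]; exact: xI.
apply: fin_bigcap_measurable => [|i _]; first exact: finite_finset.
rewrite -[X in measurable X]setTI.
by apply: measurable_rV_coord => //; exact: measurable_itv.
Qed.

(** The sigma-algebra is generated by the coordinates, so openness has to be
converted: an open set is the union of the boxes with rational corners that it
contains, and there are countably many of those. *)
Lemma open_measurable_rV A : open A -> measurable A.
Proof.
move=> oA.
pose rbox (p : 'rV[rat]_n * 'rV[rat]_n) : set 'rV[R]_n :=
  [set x | forall i, x 0 i \in `](ratr (p.1 0 i) : R), ratr (p.2 0 i)[].
rewrite (_ : A = \bigcup_p if asbool (rbox p `<=` A) then rbox p else set0).
  apply: countable_bigcupT_measurable => // p.
  by case: ifP => // _; exact: measurable_coord_box.
apply/seteqP; split=> [x Ax|x [p _]]; last by case: asboolP => // pA /pA.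
have /nbhs_ballP[e /= e0 xeA] : nbhs x A by apply: open_nbhs_nbhs.
have lo i : {q : rat | ratr q \in `](x 0 i - e), x 0 i[}.
  by apply/cid/rat_in_itvoo; rewrite ltrBlDr ltrDl.
have hi i : {q : rat | ratr q \in `]x 0 i, (x 0 i + e)[}.
  by apply/cid/rat_in_itvoo; rewrite ltrDl.
exists (\row_i sval (lo i), \row_i sval (hi i)) => //.
case: asboolP => [_ i|].
  rewrite /= !mxE; move: (svalP (lo i)) (svalP (hi i)).
  by rewrite !in_itv/= => /andP[_ ->] /andP[].
case=> y yr; apply: xeA; split => // j i; move: (yr i).
rewrite ord1 /= !mxE; move: (svalP (lo i)) (svalP (hi i)).
rewrite !in_itv/= => /andP[l _] /andP[_ h] /andP[ly yh].
rewrite /ball/= ltr_distlC; apply/andP; split; first exact: lt_trans ly.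
exact: lt_trans h.
Qed.

Lemma within_continuous_measurable_rV D (f : 'rV[R]_n -> R) :
  measurable D -> {within D, continuous f} -> measurable_fun D f.
Proof.
move=> mD /continuousP cf.
apply: (measurability _ (RGenOpens.measurableE R)).
move=> _ [_ [a [b ->] <-]].
have /open_subspaceP[V oV VD] :=
  cf _ (@interval_open R (BRight a) (BLeft b) erefl erefl).
rewrite setIC -VD.
by apply: measurableI => //; exact: open_measurable_rV.
Qed.

Definition box a b : set 'rV[R]_n := [set x | forall i, x 0 i \in `[a, b]].

Lemma measurable_box a b : measurable (box a b).
Proof. exact: measurable_coord_box. Qed.

Lemma closed_cubeE : closed_cube n = box 0 1.
Proof. by apply/seteqP; split=> x xQ i; have := xQ i; rewrite in_itv. Qed.

Lemma box_bounded a b (f : 'rV[R]_n -> R) : {within box a b, continuous f} ->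
  exists2 M, 0 <= M & forall x, box a b x -> `|f x| <= M.
Proof.
move=> cf.
have /compact_bounded[M [_ fM]] : compact (f @` box a b).
  apply: continuous_compact cf _.
  apply: (@rV_compact R n (fun=> `[a, b]%classic)) => _.
  exact: segment_compact.
exists (`|M| + 1) => // x xQ; apply: (fM (`|M| + 1)).
  by rewrite (le_lt_trans (ler_norm M))// ltrDl.
by exists x.
Qed.

Lemma open_open_cube : open (open_cube n : set 'rV[R]_n).
Proof.
rewrite openE => x xQ.
apply: (@filter_forall _ _ (fun i (y : 'rV[R]_n) => 0 < y 0 i < 1) (nbhs x)
  (nbhs_filter x)) => i.
have : nbhs (x 0 i) `]0, 1[%classic.
  by apply: open_nbhs_nbhs; split; [exact: interval_open|rewrite /= in_itv/= xQ].
move=> /(@coord_continuous R 1 n 0 i x) /=.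
have -> : `]0, 1[%classic = [set t : R | 0 < t < 1].
  by apply/seteqP; split=> t /=; rewrite in_itv.
exact.
Qed.

Lemma lebesgue_box a b : a <= b ->
  lebesgue_rV n (box a b) = ((b - a) ^+ n)%:E.
Proof.
move=> ab; rewrite (@lebesgue_rV_box R n (fun=> `[a, b]%classic))//.
rewrite (eq_bigr (fun=> (b - a)%:E)); last first.
  move=> i _; rewrite lebesgue_measure_itv/= lte_fin.
  by case: ltP => // ba; rewrite (@le_anti _ _ a b) ?subrr// ab ba.
by rewrite prodEFin prodr_const card_ord.
Qed.

Lemma within_continuous_integrable_box a b (f : 'rV[R]_n -> R) : a <= b ->
  {within box a b, continuous f} ->
  (lebesgue_rV n).-integrable (box a b) (EFin \o f).
Proof.
move=> ab cf; apply: measurable_bounded_integrable.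
- exact: measurable_box.
- by rewrite /= lebesgue_box// ltry.
- by apply: within_continuous_measurable_rV => //; exact: measurable_box.
- have [M _ fM] := box_bounded cf.
  exists M; split; first exact: num_real.
  by move=> K MK x xQ; exact: le_trans (fM _ xQ) (ltW MK).
Qed.

End topology_of_rV.

Arguments box {R} n a b.

(** * Integration along coordinate lines *)

Section vanishing_lines.
Context (R : realType).

Definition set_coord n (x : 'rV[R]_n) (i : 'I_n) (t : R) : 'rV[R]_n :=
  \row_j (if j == i then t else x 0 j).

Lemma set_coord_rV_cons0 n (t s : R) (y : 'rV[R]_n) :
  set_coord (rV_cons (s, y)) ord0 t = rV_cons (t, y).
Proof.
apply/rowP => j; rewrite !mxE; case: unliftP => [k ->|->]; last by rewrite eqxx.
by rewrite eq_sym (negbTE (neq_lift _ _)).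
Qed.

Lemma set_coord_rV_cons_lift n (t s : R) (y : 'rV[R]_n) (i : 'I_n) :
  set_coord (rV_cons (s, y)) (lift ord0 i) t = rV_cons (s, set_coord y i t).
Proof.
apply/rowP => j; rewrite !mxE; case: unliftP => [k ->|->]; last first.
  by rewrite (negbTE (neq_lift _ _)).
by rewrite (inj_eq lift_inj) mxE.
Qed.

Lemma bounded_supported_integrable d (T : measurableType d)
    (mu : {measure set T -> \bar R}) (A : set T) (f : T -> R) (M : R) :
  measurable A -> (mu A < +oo)%E -> measurable_fun setT f ->
  (forall x, A x -> `|f x| <= M) -> (forall x, ~ A x -> f x = 0) ->
  mu.-integrable setT (EFin \o f).
Proof.
move=> mA muA mf fM f0.
rewrite (_ : EFin \o f = (EFin \o f) \_ A).
  apply/(integrable_mkcond _ mA); apply: measurable_bounded_integrable => //.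
    exact: measurable_funTS.
  exists M; split; first exact: num_real.
  by move=> K MK x Ax; exact: le_trans (fM _ Ax) (ltW MK).
apply/funext => x; rewrite patchE; case: ifPn => //.
by rewrite notin_setE => /f0 /= ->.
Qed.

(** Fubini's theorem in the direction of an arbitrary axis.  The measure singles
out the first coordinate, hence the induction: a later axis is the axis of a
lower-dimensional slice.  Boundedness and support in the cube pass to every
slice, whereas integrability passes only to almost every one. *)
Lemma integral_lines_eq0 n (i : 'I_n) (F : 'rV[R]_n -> R) (M : R) :
  measurable_fun setT F ->
  (forall x, `|F x| <= M) -> (forall x, ~ closed_cube n x -> F x = 0) ->
  (forall x, (\int[lebesgue_measure]_t (F (set_coord x i t))%:E = 0)%E) ->
  (\int[lebesgue_rV n]_x (F x)%:E = 0)%E.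
Proof.
elim: n i F => [[]//|n IH] i F mF FM F0 lineF0.
have mE : measurable_fun setT (EFin \o F) by exact/measurable_EFinP.
pose P : {measure set (measurableTypeR R * 'rV[R]_n)%type -> \bar R} :=
  (lebesgue_measure \x lebesgue_rV n)%E.
have mFc : measurable_fun setT (F \o @rV_cons R n).
  by apply: measurableT_comp mF _; exact: measurable_rV_cons.
have intF : P.-integrable setT (EFin \o (F \o @rV_cons R n)).
  apply: (@bounded_supported_integrable _ _ P
    (@rV_cons R n @^-1` closed_cube n.+1) _ M) => //.
  - rewrite -[X in measurable X]setTI; apply: measurable_rV_cons => //.
    by rewrite closed_cubeE; exact: measurable_box.
  - rewrite -[ltLHS]/(lebesgue_rV n.+1 (closed_cube n.+1)).
    by rewrite closed_cubeE lebesgue_box// ltry.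
  - by move=> z _; exact: FM.
  - by move=> z zcube; exact: (F0 (rV_cons z)).
transitivity (\int[P]_z (F (rV_cons z))%:E)%E.
  exact: (@integral_pushforward _ _ _ _ R (@rV_cons R n)
    (@measurable_rV_cons R n) P setT (EFin \o F) mE intF measurableT).
case: (unliftP ord0 i) => [j ij|i0].
  rewrite -[LHS](@integral12_prod_meas1 _ _ _ _ R lebesgue_measure (lebesgue_rV n)
    (EFin \o (F \o @rV_cons R n)) intF).
  rewrite integral0_eq// => s _; apply: (IH j) => //.
  - exact: measurableT_comp mFc (pair1_measurable s).
  - by move=> y; exact: FM.
  - move=> y ycube; apply: F0 => cube; apply: ycube => k.
    by have := cube (lift ord0 k); rewrite mxE liftK.
  - by move=> y; rewrite -[RHS](lineF0 (rV_cons (s, y))) ij;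
      apply: eq_integral => t _; rewrite set_coord_rV_cons_lift.
rewrite -[LHS](@integral21_prod_meas1 _ _ _ _ R lebesgue_measure (lebesgue_rV n)
  (EFin \o (F \o @rV_cons R n)) intF).
rewrite integral0_eq// => y _; rewrite /fubini_G -[RHS](lineF0 (rV_cons (0, y))) i0.
by apply: eq_integral => t _; rewrite set_coord_rV_cons0.
Qed.

End vanishing_lines.

(** * The one-dimensional weight *)

Section bell.
Context (R : realType).
Implicit Types t : R.

(** A polynomial with double zeros at 1/4 and 3/4.  It replaces a smooth cutoff
because all integrals against it are restricted to the segment between these
zeros, where the boundary terms vanish. *)
Definition bell t : R := ((1 / 4) ^+ 2 - (t - 1 / 2) ^+ 2) ^+ 2.

Definition bell' t : R := - 4 * (t - 1 / 2) * ((1 / 4) ^+ 2 - (t - 1 / 2) ^+ 2).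

Definition bell'' t : R := 12 * (t - 1 / 2) ^+ 2 - 1 / 4.

Lemma is_derive_bell t : is_derive t 1 bell (bell' t).
Proof.
rewrite /bell; apply: is_derive_eq.
by rewrite /bell' /GRing.scale /=; ring.
Qed.

Lemma is_derive_bell' t : is_derive t 1 bell' (bell'' t).
Proof.
rewrite /bell'; apply: is_derive_eq.
by rewrite /bell'' /GRing.scale /=; field.
Qed.

Lemma bell_ge0 t : 0 <= bell t. Proof. exact: sqr_ge0. Qed.

Lemma bell_le1 t : 1 / 4 <= t <= 3 / 4 -> bell t <= 1.
Proof. by rewrite /bell => /andP[? ?]; nra. Qed.

Lemma normr_bell''_le1 t : 1 / 4 <= t <= 3 / 4 -> `|bell'' t| <= 1.
Proof. by rewrite /bell'' ler_norml => /andP[? ?]; apply/andP; split; nra. Qed.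

Lemma bell_ge t : 3 / 8 <= t <= 5 / 8 -> (1 / 32) ^+ 2 <= bell t.
Proof.
move=> /andP[? ?]; rewrite /bell.
have : 3 / 64 <= (1 / 4) ^+ 2 - (t - 1 / 2) ^+ 2 by nra.
by move: (_ - _) => s; nra.
Qed.

Lemma continuous_bell : continuous bell.
Proof.
by move=> t; apply: differentiable_continuous; apply/derivable1_diffP;
  have [] := is_derive_bell t.
Qed.

Lemma continuous_bell'' : continuous bell''.
Proof.
have d t : derivable bell'' t 1 by rewrite /bell''; apply: ex_derive.
by move=> t; apply: differentiable_continuous; apply/derivable1_diffP.
Qed.

(** The integrand is the derivative of [bell * v' - v * bell'], which vanishes at
1/4 and 3/4 because [bell] has double zeros there. *)
Lemma bell_integration_by_parts (v v' v'' : R -> R) :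
  (forall t, 0 < t < 1 -> is_derive t 1 v (v' t)) ->
  (forall t, 0 < t < 1 -> is_derive t 1 v' (v'' t)) ->
  {within `[1 / 4, 3 / 4], continuous v''} ->
  (\int[lebesgue_measure]_(t in `[(1 / 4)%R, (3 / 4)%R])
     (bell t * v'' t - v t * bell'' t)%R%:E = 0)%E.
Proof.
move=> dv dv' cv''.
(* G' has no first-order terms: the two products bell' * v' cancel. *)
pose G t := bell t * v' t - v t * bell' t.
have cG t : 0 < t < 1 -> is_derive t 1 G (bell t * v'' t - v t * bell'' t).
  move=> t01; have := dv t t01; have := dv' t t01.
  have := is_derive_bell t; have := is_derive_bell' t => *.
  apply: is_derive_eq.
  by rewrite /GRing.scale /=; ring.
have ccG t : 0 < t < 1 -> {for t, continuous G}.
  by move=> t01; apply: differentiable_continuous; apply/derivable1_diffP;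
    have [] := cG t t01.
have lt : 1 / 4 < 3 / 4 :> R by lra.
rewrite (continuous_FTC2 (F := G) lt).
- by rewrite -EFinB /G /bell /bell'; congr EFin; field.
- have cv : {within `[1 / 4, 3 / 4], continuous v}.
    apply: continuous_in_subspaceT => t; rewrite inE/= in_itv/= => t01.
    apply: differentiable_continuous; apply/derivable1_diffP.
    by have [] : is_derive t 1 v (v' t) by apply: dv; lra.
  move=> t; apply: cvgB; apply: cvgM.
  + by apply: continuous_subspaceT; exact: continuous_bell.
  + exact: cv''.
  + exact: cv.
  + by apply: continuous_subspaceT; exact: continuous_bell''.
- split.
  + by move=> t; rewrite in_itv/= => t01; have [] := cG t ltac:(lra).
  + by apply: cvg_at_right_filter; apply: ccG; lra.
  + by apply: cvg_at_left_filter; apply: ccG; lra.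
- move=> t; rewrite in_itv/= => t01; rewrite derive1E.
  by apply: derive_val; apply: cG; lra.
Qed.

End bell.

(** * Differentiation along coordinate lines *)

Section coordinate_lines.
Context (R : realType) (n : nat).
Implicit Types (x : 'rV[R]_n) (i : 'I_n) (t : R).

Lemma set_coordE x i t : set_coord x i t 0 i = t.
Proof. by rewrite mxE eqxx. Qed.

Lemma set_coord_neq x i j t : j != i -> set_coord x i t 0 j = x 0 j.
Proof. by rewrite mxE => /negbTE ->. Qed.

Lemma set_coordD x i t h : set_coord x i (h + t) = h *: 'e_i + set_coord x i t.
Proof.
apply/rowP => j; rewrite !mxE eqxx /=.
by case: eqP => _; rewrite ?mulr1// mulr0 add0r.
Qed.

Lemma is_derive_set_coord (f : 'rV[R]_n -> R) x i t :
  derivable f (set_coord x i t) 'e_i ->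
  is_derive t 1 (fun s => f (set_coord x i s)) (partial i f (set_coord x i t)).
Proof.
move=> df; have E :
   (fun h => h^-1 *: (((fun s => f (set_coord x i s)) \o shift t) (h *: 1)
     - f (set_coord x i t))) =
   (fun h => h^-1 *: ((f \o shift (set_coord x i t)) (h *: 'e_i)
     - f (set_coord x i t))).
  by apply/funext => h /=; rewrite -set_coordD /GRing.scale /= mulr1.
by apply: DeriveDef; rewrite /derivable /partial /derive E.
Qed.

Lemma continuous_set_coord x i : continuous (set_coord x i).
Proof.
move=> t A /nbhs_ballP[e /= e0 eA]; apply/nbhs_ballP; exists e => //= s ts.
apply: eA; split => // k j; rewrite ord1 !mxE; case: ifP => // _.
exact: ballxx.
Qed.

End coordinate_lines.

(** * Green's identity on the inner box *)

Section flux.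
Context (R : realType) (n : nat).
Implicit Types (x : 'rV[R]_n) (i : 'I_n).

Definition weight x : R := \prod_j bell (x 0 j).

(** The factor of [weight] that is constant along lines parallel to the [i]-th
axis. *)
Definition coweight i x : R := \prod_(j | j != i) bell (x 0 j).

(** The [i]-th term w d_i d_i u - u d_i d_i w of Green's identity, that is, the
[i]-th partial derivative of w d_i u - u d_i w. *)
Definition flux_div (u : 'rV[R]_n -> R) i x : R :=
  coweight i x *
    (bell (x 0 i) * partial i (partial i u) x - u x * bell'' (x 0 i)).

Lemma weightE i x : weight x = coweight i x * bell (x 0 i).
Proof. by rewrite /weight (bigD1 i)//= mulrC. Qed.

Lemma coweight_ge0 i x : 0 <= coweight i x.
Proof. by apply: prodr_ge0 => j _; exact: bell_ge0. Qed.

Lemma coweight_le1 i x : box n (1 / 4) (3 / 4) x -> coweight i x <= 1.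
Proof.
move=> xQ; apply: prodr_ile1 => j _; rewrite bell_ge0 bell_le1//.
by have := xQ j; rewrite in_itv.
Qed.

Lemma coweight_set_coord i x t : coweight i (set_coord x i t) = coweight i x.
Proof. by apply: eq_bigr => j ji; rewrite set_coord_neq. Qed.

Lemma continuous_bell_prod (P : pred 'I_n) :
  continuous (fun x : 'rV[R]_n => \prod_(j | P j) bell (x 0 j)).
Proof.
apply: (@continuous_big R 'I_n *%R 1 P (@mul_continuous R)) => j _ x.
exact: (continuous_comp (@coord_continuous R 1 n 0 j x) (@continuous_bell R _)).
Qed.

Context (u : 'rV[R]_n -> R).
Context (u_C0 : {within closed_cube n, continuous u}).
Context (u_C2 : continuously_differentiable 2 (open_cube n) u).

Let Q := box n (1 / 4 : R) (3 / 4).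

Lemma inner_box_open_cube : Q `<=` open_cube n.
Proof. by move=> x xQ i; have := xQ i; rewrite in_itv/=; lra. Qed.

Lemma inner_box_closed_cube : Q `<=` closed_cube n.
Proof. by move=> x xQ i; have := xQ i; rewrite in_itv/=; lra. Qed.

Lemma within_continuous_flux i : {within Q, continuous (flux_div u i)}.
Proof.
have cu : {within Q, continuous u}.
  exact: continuous_subspaceW inner_box_closed_cube u_C0.
have cuii : {within Q, continuous (partial i (partial i u))}.
  have [_ /(_ i)[_ [_ /(_ i)[_ [+ _]]]]] := u_C2.
  exact: continuous_subspaceW inner_box_open_cube.
have cc (f : R -> R) : continuous f ->
    {within Q, continuous (fun x : 'rV[R]_n => f (x 0 i))}.
  move=> cf; apply: continuous_subspaceT => x.
  exact: (continuous_comp (@coord_continuous R 1 n 0 i x) (cf _)).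
have cw : {within Q, continuous (coweight i)}.
  by apply: continuous_subspaceT; exact: continuous_bell_prod.
move=> x; apply: cvgM; first exact: cw.
apply: cvgB; apply: cvgM; [|exact: cuii|exact: cu|].
  exact: (cc (@bell R) (@continuous_bell R)).
exact: (cc (@bell'' R) (@continuous_bell'' R)).
Qed.

(** Such a line either misses the box or meets it in the segment [1/4, 3/4]; in
the second case the cofactor of the weight is constant along the line and is
absorbed in [u], which leaves the one-dimensional identity. *)
Lemma flux_line_integral i x :
  (\int[lebesgue_measure]_t ((flux_div u i \_ Q) (set_coord x i t))%:E = 0)%E.
Proof.
have [xQ|] := pselect (forall j, j != i -> x 0 j \in `[(1 / 4 : R), 3 / 4]);
    last first.
  move=> xQ; apply: integral0_eq => t _; rewrite patchE.
  case: ifPn => // /set_mem tQ; exfalso; apply: xQ => j ji.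
  by rewrite -(set_coord_neq x t ji); exact: tQ.
have memQ t : (set_coord x i t \in Q) = (t \in `[(1 / 4 : R), 3 / 4]).
  apply/idP/idP => [/set_mem/(_ i)|tI]; first by rewrite set_coordE.
  apply/mem_set => j; have [->|ji] := eqVneq j i; first by rewrite set_coordE.
  by rewrite set_coord_neq//; exact: xQ.
have line01 t : 0 < t < 1 -> open_cube n (set_coord x i t).
  move=> t01 j; have [->|ji] := eqVneq j i; first by rewrite set_coordE.
  by rewrite set_coord_neq//; have := xQ j ji; rewrite in_itv/=; lra.
pose c := coweight i x.
rewrite -[RHS](@bell_integration_by_parts R
  (fun t => c * u (set_coord x i t))
  (fun t => c * partial i u (set_coord x i t))
  (fun t => c * partial i (partial i u) (set_coord x i t))).
- rewrite [RHS]integral_mkcond; apply: eq_integral => t _.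
  rewrite !patchE memQ mem_setE; case: ifP => //= _.
  by rewrite /flux_div coweight_set_coord set_coordE -/c; congr EFin; ring.
- move=> t t01.
  have [_ /(_ i)[/(_ _ (line01 _ t01)) du _]] := u_C2.
  have := is_derive_set_coord du => dt.
  by apply: is_derive_eq; rewrite /GRing.scale/=; ring.
- move=> t t01.
  have [_ /(_ i)[_ [_ /(_ i)[/(_ _ (line01 _ t01)) du _]]]] := u_C2.
  have := is_derive_set_coord du => dt.
  by apply: is_derive_eq; rewrite /GRing.scale/=; ring.
- apply: continuous_in_subspaceT => t; rewrite inE/= in_itv/= => t01.
  apply: cvgM; first exact: cvg_cst.
  apply: (@continuous_comp _ _ _ (set_coord x i) (partial i (partial i u))).
    exact: continuous_set_coord.
  have [_ /(_ i)[_ [_ /(_ i)[_ [+ _]]]]] := u_C2.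
  rewrite continuous_open_subspace; last exact: open_open_cube.
  by apply; apply/mem_set/line01; lra.
Qed.

Lemma flux_integral i : (\int[lebesgue_rV n]_(x in Q) (flux_div u i x)%:E = 0)%E.
Proof.
have -> : (\int[lebesgue_rV n]_(x in Q) (flux_div u i x)%:E =
    \int[lebesgue_rV n]_x ((flux_div u i \_ Q) x)%:E)%E.
  rewrite integral_mkcond; apply: eq_integral => x _.
  by rewrite !patchE; case: ifP.
have [M M0 fM] := box_bounded (@within_continuous_flux i).
apply: (@integral_lines_eq0 R n i _ M) => [|x|x xC|].
- apply: (measurable_restrictT _ (measurable_box _ _)).1.
  apply: within_continuous_measurable_rV; first exact: measurable_box.
  exact: within_continuous_flux.
- by rewrite patchE; case: ifPn => [/set_mem/fM//|_]; rewrite normr0.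
- rewrite patchE; case: ifPn => // /set_mem xQ.
  by case: xC; exact: inner_box_closed_cube.
- exact: flux_line_integral.
Qed.

End flux.

(** * Mass of a function above and below a level *)

Section Lnorm_split.
Context d (T : measurableType d) (R : realType) (mu : {measure set T -> \bar R}).

(** Off the superlevel set [|f|] is at most [c], and on it [|f|] is almost
everywhere at most the essential supremum. *)
Lemma integral_le_Lnormy (C : set T) (f : T -> R) (c : R) :
  measurable C -> measurable_fun C f -> (0 < mu setT)%E -> 0 <= c ->
  (\int[mu]_(x in C) `|f x|%:E <= c%:E * mu C +
     mu [set x | C x /\ (c <= `|f x|)%R] * 'N[mu]_+oo[(EFin \o f) \_ C])%E.
Proof.
move=> mC mf muT c0; set A := [set x | _].
have mabs : measurable_fun C (Num.norm \o f) by exact: measurableT_comp.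
have AE : A = C `&` (Num.norm \o f) @^-1` `[c, +oo[%classic.
  by apply/seteqP; split=> x /=; rewrite in_itv/= andbT.
have mA : measurable A by rewrite AE; apply: mabs => //; exact: measurable_itv.
have AC : A `<=` C by move=> x [].
have mD : measurable (C `\` A) by exact: measurableD.
have mEf : measurable_fun C (fun x => `|f x|%:E) by exact/measurable_EFinP.
rewrite -(setDUK AC) setUC ge0_integral_setU//; last 2 first.
- by rewrite setUC setDUK.
- by apply/disj_setPS => x [[_ nAx] Ax].
apply: leeD.
  apply: (@le_trans _ _ (\int[mu]_(x in C `\` A) c%:E)%E).
    apply: ge0_le_integral => //.
    - exact: measurable_funS mEf.
    - move=> x [Cx nAx]; rewrite lee_fin leNgt; apply/negP => cf; apply: nAx.
      by split => //; exact: ltW.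
  rewrite integral_cst// lee_wpmul2l// ?lee_fin//.
  by rewrite setUC setDUK// le_measure ?inE//; exact: subDsetl.
rewrite setUC setDUK// muleC -integral_cst//.
apply: ae_ge0_le_integral => //.
- exact: measurable_funS mEf.
- by move=> x _; exact: Lnorm_ge0.
rewrite unlock muT.
apply: filterS (ess_sup_ge mu (abse \o (EFin \o f) \_ C)) => x + Ax.
by rewrite /= patchE mem_set//; exact: AC.
Qed.

End Lnorm_split.

(** * Lower bound for the mass of a function with large Laplacian *)

Section laplacian_mass.
Context (R : realType) (n : nat) (u : 'rV[R]_n -> R).
Context (u_C0 : {within closed_cube n, continuous u}).
Context (u_C2 : continuously_differentiable 2 (open_cube n) u).
Context (lap_ge1 : forall x, open_cube n x -> 1 <= laplacian u x).

Let Q := box n (1 / 4 : R) (3 / 4).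

(** Summing the terms of Green's identity gives w Delta u - u Delta w; here
w <= w Delta u, and each of the [n] terms of Delta w is at most 1 in absolute
value. *)
Lemma weight_le_flux (x : 'rV[R]_n) : Q x ->
  weight x <= \sum_i flux_div u i x + n%:R * `|u x|.
Proof.
move=> xQ.
have lap : weight x <= weight x * laplacian u x.
  rewrite ler_peMr ?lap_ge1//; last exact: inner_box_open_cube.
  by apply: prodr_ge0 => j _; exact: bell_ge0.
apply: le_trans lap _; rewrite /laplacian mulr_sumr.
have -> : n%:R * `|u x| = \sum_(i < n) `|u x|.
  by rewrite sumr_const card_ord mulr_natl.
rewrite -big_split/=; apply: ler_sum => i _.
rewrite (weightE i) /flux_div -subr_ge0.
rewrite (_ : _ - _ = `|u x| - coweight i x * (u x * bell'' (x 0 i))); last by ring.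
rewrite subr_ge0.
apply: le_trans (ler_norm _) _; rewrite !normrM mulrCA.
rewrite ler_piMr// (ger0_norm (coweight_ge0 _ _)).
rewrite mulr_ile1 ?coweight_ge0 ?coweight_le1//.
by rewrite normr_bell''_le1//; have := xQ i; rewrite in_itv.
Qed.

Lemma weight_ge (x : 'rV[R]_n) : box n (3 / 8) (5 / 8) x ->
  ((1 / 32) ^+ 2) ^+ n <= weight x.
Proof.
move=> xQ; rewrite -[X in _ ^+ X](card_ord n) -prodr_const.
apply: ler_prod => i _; rewrite bell_ge ?andbT; last first.
  by have := xQ i; rewrite in_itv.
exact: sqr_ge0.
Qed.

(** On the smaller box [3/8, 5/8]^n, of volume 4^-n, the weight is at least
32^-(2n). *)
Lemma integral_weight_ge :
  ((((1 / 64) ^+ 2) ^+ n)%:E <= \int[lebesgue_rV n]_(x in Q) (weight x)%:E)%E.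
Proof.
have mw : measurable_fun Q (EFin \o @weight R n).
  apply/measurable_EFinP; apply: within_continuous_measurable_rV.
    exact: measurable_box.
  by apply: continuous_subspaceT; exact: continuous_bell_prod.
have w0 (x : 'rV[R]_n) : 0 <= weight x.
  by apply: prodr_ge0 => j _; exact: bell_ge0.
have sub : box n (3 / 8 : R) (5 / 8) `<=` Q.
  by move=> x xQ i; have := xQ i; rewrite !in_itv/=; lra.
apply: (@le_trans _ _ (\int[lebesgue_rV n]_(x in box n (3 / 8 : R)%R (5 / 8)%R)
    (weight x)%:E)%E); last first.
  apply: ge0_subset_integral => //; [exact: measurable_box..|].
  by move=> x _; rewrite lee_fin.
apply: (@le_trans _ _ (\int[lebesgue_rV n]_(x in box n (3 / 8 : R)%R (5 / 8)%R)
    (((1 / 32) ^+ 2) ^+ n)%R%:E)%E).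
  rewrite integral_cst; last exact: measurable_box.
  rewrite /= lebesgue_box; last by lra.
  rewrite -EFinM -exprMn lee_fin.
  have -> : (1 / 64) ^+ 2 = (1 / 32) ^+ 2 * (5 / 8 - 3 / 8) :> R by field.
  exact: lexx.
apply: ge0_le_integral; first exact: measurable_box.
- by move=> x _; rewrite lee_fin; apply: exprn_ge0; exact: sqr_ge0.
- exact: measurable_cst.
- by apply: measurable_funS mw => //; exact: measurable_box.
- by move=> x xQ; rewrite lee_fin weight_ge.
Qed.

(** Integrating [weight_le_flux] over the inner box, the flux terms disappear. *)
Lemma integral_normr_ge : ((((1 / 64) ^+ 2) ^+ n)%:E <=
  n%:R%:E * \int[lebesgue_rV n]_(x in closed_cube n) `|u x|%:E)%E.
Proof.
have mC : measurable (closed_cube n : set 'rV[R]_n).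
  by rewrite closed_cubeE; exact: measurable_box.
have mQ : measurable Q by exact: measurable_box.
have lt : 1 / 4 <= 3 / 4 :> R by lra.
have cu : {within Q, continuous u}.
  exact: continuous_subspaceW (@inner_box_closed_cube R n) u_C0.
have iF i : (lebesgue_rV n).-integrable Q (EFin \o flux_div u i).
  by apply: within_continuous_integrable_box => //; exact: within_continuous_flux.
have iS : (lebesgue_rV n).-integrable Q
    (fun x => \sum_(i < n) (flux_div u i x)%:E)%E.
  exact: (@integrable_sum _ _ _ (lebesgue_rV n) Q mQ _ _ _ _ (fun i _ => iF i)).
have iu : (lebesgue_rV n).-integrable Q (fun x => n%:R%:E * `|u x|%:E)%E.
  apply: integrableZl => //.
  apply: within_continuous_integrable_box => // x.
  by apply: cvg_norm; exact: cu.
apply: le_trans integral_weight_ge _.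
apply: (@le_trans _ _ (\int[lebesgue_rV n]_(x in Q)
    ((\sum_i (flux_div u i x)%:E) + n%:R%:E * `|u x|%:E))%E).
  apply: le_integral => //.
  - apply: within_continuous_integrable_box => //.
    by apply: continuous_subspaceT; exact: continuous_bell_prod.
  - by apply: integrableD.
  - move=> x /set_mem xQ.
    by rewrite sumEFin -EFinM -EFinD lee_fin weight_le_flux.
rewrite integralD//.
rewrite integral_sum// big1 ?add0e; last by move=> i _; exact: flux_integral.
have mau : measurable_fun (closed_cube n) (fun x => `|u x|%:E).
  apply/measurable_EFinP/measurableT_comp => //.
  exact: within_continuous_measurable_rV.
rewrite ge0_integralZl//; last first.
  by apply: measurable_funS mau => //; exact: inner_box_closed_cube.
rewrite lee_wpmul2l ?lee_fin//; apply: ge0_subset_integral => //.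
exact: inner_box_closed_cube.
Qed.

End laplacian_mass.

(** * The superlevel set estimate *)

Theorem theorem3 (R : realType) (n : nat) (hn : (1 <= n)%N) :
  exists c : R, 0 < c /\
    forall u : 'rV[R]_n -> R,
      {within closed_cube n, continuous u} ->
      continuously_differentiable 2 (open_cube n) u ->
      (forall x, open_cube n x -> 1 <= laplacian u x) ->
      (c%:E <= lebesgue_rV n [set x | closed_cube n x /\ (c <= `|u x|)%R]
               * 'N[lebesgue_rV n]_+oo[(EFin \o u) \_ (closed_cube n)])%E.
Proof.
(* Half of the lower bound for the integral of [|u|]. *)
pose c : R := ((1 / 64) ^+ 2) ^+ n / (2 * n%:R).
have n0 : 0 < n%:R :> R by rewrite ltr0n.
have c0 : 0 < c.
  apply: divr_gt0; last by rewrite mulr_gt0.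
  by apply: exprn_gt0; apply: exprn_gt0; rewrite divr_gt0.
exists c; split=> // u u_C0 u_C2 lap_ge1.
have mC : measurable (closed_cube n : set 'rV[R]_n).
  by rewrite closed_cubeE; exact: measurable_box.
have muC : lebesgue_rV n (closed_cube n : set 'rV[R]_n) = 1%E.
  by rewrite closed_cubeE lebesgue_box// subr0 expr1n.
have muT : (0 < lebesgue_rV n [set: 'rV[R]_n])%E.
  apply: (@lt_le_trans _ _ (lebesgue_rV n (closed_cube n))).
    by rewrite muC lte_fin.
  by rewrite le_measure ?inE.
have := integral_le_Lnormy mC (within_continuous_measurable_rV mC u_C0) muT (ltW c0).
rewrite /= muC mule1.
set X := (_ * 'N[_]_+oo[_])%E => le_cX.
have := le_trans (integral_normr_ge u_C0 u_C2 lap_ge1)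
  (lee_wpmul2l (_ : (0 <= n%:R%:E)%E) le_cX).
have -> : ((1 / 64) ^+ 2) ^+ n = n%:R * (c + c) :> R.
  by rewrite /c; field; rewrite pnatr_eq0 -lt0n.
rewrite EFinM lee_pmul2l// ?lte_fin// EFinD => /(_ (ltW n0)).
by rewrite leeD2lE.
Qed.
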